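(* If $\alpha>0$ and $B$ is a compact metric space with $\overline{\dim}_B B<1/\alpha$, then $B$ can be obtained as the $\alpha$-Hölder image of a compact subset of $[0,1]$; that is, there exist a compact set $D\subset[0,1]$ and an $\alpha$-Hölder onto map $g\colon D\to B$.
   Context: For a compact metric space $X$ and $r>0$ let $N(X,r)$ be the minimal number of closed balls of radius $r$ (centered in $X$) that cover $X$; the upper box dimension is $\overline{\dim}_B X=\limsup_{r\to0+}\frac{\log N(X,r)}{\log(1/r)}\in[0,\infty]$ for nonempty $X$ (and $0$ for the empty set). For $\alpha>0$, a map $f$ between metric spaces is $\alpha$-Hölder if there is a finite $C$ with $d_Y(f(x),f(z))\le C\,d_X(x,z)^\alpha$ for all $x,z$ in its domain ($\alpha>1$ is allowed). *)

(* Defs.v *)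
From HB Require Import structures.
From mathcomp Require Import all_boot all_order all_algebra.
From mathcomp Require Import all_classical all_reals all_analysis.

Set Implicit Arguments.
Unset Strict Implicit.
Unset Printing Implicit Defensive.

Import Order.TTheory GRing.Theory Num.Theory.
Import numFieldNormedType.Exports.

Local Open Scope classical_set_scope.
Local Open Scope ring_scope.

(* The library's [closed_ball] is the closure of the open ball, which in a
   general metric space may be strictly smaller than [mclosed_ball]. *)
Definition mclosed_ball (R : realType) (X : metricType R) (c : X) (r : R) :
  set X := [set y | mdist c y <= r].

Definition ball_cover (R : realType) (X : metricType R) (r : R) :
  set (seq X) :=
  [set s | [set: X] `<=` \bigcup_(c in [set` s]) mclosed_ball c r].

(* An infimum of a set of natural numbers: it is attained as soon as a finite
   cover exists (in particular for X compact and r > 0), and it is +oo when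
   there is no finite cover. *)
Definition covering_number (R : realType) (X : metricType R) (r : R) :
  \bar R :=
  ereal_inf [set ((size s)%:R : R)%:E | s in @ball_cover R X r].

Definition upper_box_dim (R : realType) (X : metricType R) : \bar R :=
  if [set: X] == set0 then 0%E
  else limf_esup
    (fun r : R => (lne (covering_number X r) / (ln r^-1)%:E)%E) 0^'+.

(* The domain D carries the metric induced by X. *)
Definition holder (R : realType) (X Y : metricType R) (D : set X)
    (alpha : R) (f : D -> Y) : Prop :=
  exists C : R, forall x z : D,
    mdist (f x) (f z) <= C * mdist (\val x) (\val z) `^ alpha.

(* Main.v *)
(* Fix s with dim B < s < 1/alpha and put t = 2^(-1/(s alpha)) < 1/2 and
   r = t^alpha = 2^(-1/s).  At every level k there is a net of 2^k points with
   mesh O(r^k); joining each net point to a nearby point of the previous level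
   makes the net points the nodes of a tree.  Order the nodes depth-first and
   give each node of level k the mass t^k; the total mass is finite because
   2t < 1.  Sending a node to the mass of its predecessors is an injection into
   the line, and two nodes whose branches first differ at level m are sent to
   points at distance at least c t^m, while they lie within
   O(r^m) = O((t^m)^alpha) of each other in B.  Hence the inverse map is
   alpha-Hölder with dense image; the closure of its graph in [0,1] x B is the
   graph of g. *)
Require Import Defs.
From mathcomp Require Import all_boot all_order all_algebra.
From mathcomp Require Import all_classical all_reals all_analysis.
From mathcomp Require Import zify lra.
Set Implicit Arguments.
Unset Strict Implicit.
Unset Printing Implicit Defensive.

Import Order.TTheory GRing.Theory Num.Theory.
Import numFieldNormedType.Exports.
Local Open Scope classical_set_scope.
Local Open Scope ring_scope.

(** * Lexicographic order on integer sequences *)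

Definition lex_lt (f g : nat -> nat) : Prop :=
  exists m, (forall i, (i < m)%N -> f i = g i) /\ (f m < g m)%N.

Lemma lex_lt_trans f g h : lex_lt f g -> lex_lt g h -> lex_lt f h.
Proof.
move=> [m [fg fgm]] [n [gh ghn]]; case: (ltngtP m n) => mn.
- exists m; split=> [i im|]; last by rewrite -gh.
  by rewrite fg// gh//; lia.
- exists n; split=> [i im|]; last by rewrite fg.
  by rewrite fg ?gh//; lia.
- subst n; exists m; split=> [i im|]; last by lia.
  by rewrite fg ?gh.
Qed.

Lemma lex_lt_total f g : f = g \/ lex_lt f g \/ lex_lt g f.
Proof.
have [/funext ->|/existsNP[n0 n0P]] := pselect (forall n, f n = g n).
  by left.
right.
have ex : exists n, f n != g n by exists n0; exact/eqP.
case: (ex_minnP ex) => m fgm mP.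
have eqi i : (i < m)%N -> f i = g i.
  by move=> im; apply/eqP; apply: contraTT im => /mP; rewrite -leqNgt.
case: (ltngtP (f m) (g m)) => [lt|lt|/eqP e]; last by rewrite e in fgm.
- by left; exists m.
- by right; exists m; split => // i /eqi.
Qed.

(* Levels [k > l] below the node [(l, i)] carry the value [2 ^ k], larger than
   every index, so in the lexicographic order a node comes after all its
   descendants. *)
Fixpoint ancestor (p : nat -> nat -> nat) (l i k : nat) : nat :=
  if k == l then i else
  if (l < k)%N then (2 ^ k)%N else
  if l is l'.+1 then ancestor p l' (p l' i) k else i.

(** * Paths of nodes, and counts of preceding nodes level by level *)

Section Ancestor.
Variable p : nat -> nat -> nat.
Hypothesis p_lt : forall l i, (p l i < 2 ^ l)%N.

Lemma ancestor_id l i : ancestor p l i l = i.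
Proof. by case: l => [|l] /=; rewrite ?eqxx. Qed.

Lemma ancestor_gt l i k : (l < k)%N -> ancestor p l i k = (2 ^ k)%N.
Proof. by case: l => [|l] lk /=; rewrite lk gtn_eqF. Qed.

Lemma ancestorS l i k : (k <= l)%N ->
  ancestor p l.+1 i k = ancestor p l (p l i) k.
Proof. by move=> kl /=; rewrite ltn_eqF// ltnNge (leq_trans kl). Qed.

Lemma ancestor_lt l i k : (i < 2 ^ l)%N -> (k <= l)%N ->
  (ancestor p l i k < 2 ^ k)%N.
Proof.
elim: l i => [|l ih] i il.
  by rewrite leqn0 => /eqP ->; rewrite ancestor_id.
rewrite leq_eqVlt => /predU1P[->|kl]; first by rewrite ancestor_id.
by rewrite ancestorS// ih.
Qed.

Lemma ancestor_le l i k : (i < 2 ^ l)%N -> (ancestor p l i k <= 2 ^ k)%N.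
Proof.
move=> il; have [kl|kl] := leqP k l; first by rewrite ltnW// ancestor_lt.
by rewrite ancestor_gt.
Qed.

Lemma ancestor_level l i k : (ancestor p l i k < 2 ^ k)%N -> (k <= l)%N.
Proof. by case: (leqP k l) => // /(ancestor_gt i) ->; rewrite ltnn. Qed.

Lemma ancestorK l i k j : (j <= k)%N -> (k <= l)%N ->
  ancestor p k (ancestor p l i k) j = ancestor p l i j.
Proof.
elim: l i => [|l ih] i jk.
  by rewrite leqn0 => /eqP k0; move: jk; rewrite k0 ancestor_id.
rewrite leq_eqVlt => /predU1P[->|kl]; first by rewrite ancestor_id.
by rewrite !ancestorS//; [exact: ih|lia].
Qed.

(** Times [t ^+ k], this is the mass that level [k] contributes before [f] in the depth-first
    order. *)
Definition level_count (k : nat) (f : nat -> nat) : nat :=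
  #|[pred i : 'I_(2 ^ k) | `[< lex_lt (ancestor p k i) f >]]|.

Lemma level_count_le k f : (level_count k f <= 2 ^ k)%N.
Proof. by rewrite -[leqRHS]card_ord max_card. Qed.

Lemma level_count_mono k f g : lex_lt f g ->
  (level_count k f <= level_count k g)%N.
Proof.
move=> fg; apply/subset_leq_card/fintype.subsetP => i.
rewrite !unfold_in /= => /asboolP kf; apply/asboolP.
exact: lex_lt_trans kf fg.
Qed.

(** The level-[m] ancestor of [(l, i)] is counted on the right only: its path agrees with that of
    [(l, i)] through level [m] and then takes the maximal values [2 ^ n], so it precedes [(l', i')]
    but not [(l, i)]. *)
Lemma level_count_ltn l i l' i' m : (i < 2 ^ l)%N -> (i' < 2 ^ l')%N ->
  (forall k, (k < m)%N -> ancestor p l i k = ancestor p l' i' k) ->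
  (ancestor p l i m < ancestor p l' i' m)%N ->
  (level_count m (ancestor p l i) < level_count m (ancestor p l' i'))%N.
Proof.
move=> il il' eqm ltm.
have am : (ancestor p l i m < 2 ^ m)%N.
  by rewrite (leq_trans ltm)// ancestor_le.
have ml := ancestor_level am.
apply/proper_card/properP; split.
  apply/fintype.subsetP => j; rewrite !unfold_in /= => /asboolP kf.
  apply/asboolP.
  by apply: lex_lt_trans kf _; exists m.
exists (Ordinal am); rewrite !unfold_in /=.
  apply/asboolP; exists m; split => [j jm|]; last by rewrite ancestor_id.
  by rewrite ancestorK// ?eqm// ltnW.
apply/asboolP => -[n [_]]; have [nm|mn] := leqP n m.
  by rewrite ancestorK// ltnn.
by rewrite ancestor_gt// ltnNge ancestor_le.
Qed.

End Ancestor.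

(** * Embedding of the nodes into the unit interval *)

Section Position.
Variables (R : realType) (p : nat -> nat -> nat) (t : R).
Hypothesis p_lt : forall l i, (p l i < 2 ^ l)%N.
Hypotheses (t_gt0 : 0 < t) (t_lt : 2 * t < 1).

Let c_gt0 : 0 < 1 - 2 * t. Proof. by rewrite subr_gt0. Qed.
Let c_ge0 := ltW c_gt0.
Let t_ge0 := ltW t_gt0.

Let partial (f : nat -> nat) (n : nat) : R :=
  \sum_(k < n) t ^+ k * (level_count p k f)%:R.

(** The supremum is the sum of the series, whose terms are nonnegative; the total mass is at most
    the sum of [(2 * t) ^+ k], and the factor normalises that bound to 1. *)
Definition position (f : nat -> nat) : R :=
  (1 - 2 * t) * sup (range (partial f)).

Let partial_ge0 f n : 0 <= partial f n.
Proof. by apply: sumr_ge0 => k _; rewrite mulr_ge0// exprn_ge0. Qed.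

Let partial_le f n : (1 - 2 * t) * partial f n <= 1.
Proof.
apply: (@le_trans _ _ ((1 - 2 * t) * \sum_(k < n) (2 * t) ^+ k)).
  rewrite ler_wpM2l//; apply: ler_sum => k _.
  rewrite exprMn mulrC ler_wpM2r ?exprn_ge0//.
  by rewrite -natrX ler_nat level_count_le.
have /(congr1 -%R) := subrX1 (2 * t) n.
rewrite -mulNr !opprB => <-.
by rewrite gerBl exprn_ge0// mulr_ge0.
Qed.

Let partial_homo f m n : (m <= n)%N -> partial f m <= partial f n.
Proof.
move=> mn; rewrite /partial.
rewrite -!(big_mkord xpredT (fun k => t ^+ k * (level_count p k f)%:R)).
rewrite (big_cat_nat (leq0n _) mn)/= lerDl.
by apply: sumr_ge0 => k _; rewrite mulr_ge0// exprn_ge0.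
Qed.

Let partial_sup f : has_sup (range (partial f)).
Proof.
split; first by exists (partial f 0%N), 0%N.
exists (1 - 2 * t)^-1 => _ [n _ <-].
by rewrite -[leRHS]mul1r ler_pdivlMr// mulrC.
Qed.

Lemma position_ge0 f : 0 <= position f.
Proof.
rewrite mulr_ge0//; apply: le_trans (partial_ge0 f 0) _.
by apply: sup_upper_bound => //; exists 0%N.
Qed.

Lemma position_le1 f : position f <= 1.
Proof.
rewrite /position mulrC -ler_pdivlMr//; apply: ge_sup => [|_ [n _ <-]].
  exact: (partial_sup f).1.
by rewrite ler_pdivlMr// mulrC.
Qed.

(** Passing to the later node lowers no level count and raises that of level [m] by at least one,
    which is worth [t ^+ m]. *)
Lemma position_gap l i l' i' m : (i < 2 ^ l)%N -> (i' < 2 ^ l')%N ->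
  (forall k, (k < m)%N -> ancestor p l i k = ancestor p l' i' k) ->
  (ancestor p l i m < ancestor p l' i' m)%N ->
  (1 - 2 * t) * t ^+ m <=
    position (ancestor p l' i') - position (ancestor p l i).
Proof.
move=> il il' eqm ltm; rewrite /position -mulrBr ler_wpM2l//.
rewrite lerBrDr -lerBrDl; apply: ge_sup; first exact: (partial_sup _).1.
move=> _ [n _ <-]; rewrite lerBrDl.
have fg : lex_lt (ancestor p l i) (ancestor p l' i') by exists m.
(* The partial sums are lengthened so that the term of level [m] occurs in them. *)
apply: (@le_trans _ _ (partial (ancestor p l' i') (maxn n m.+1))); last first.
  by apply: sup_upper_bound => //; exists (maxn n m.+1).
apply: (@le_trans _ _ (t ^+ m + partial (ancestor p l i) (maxn n m.+1))).
  by rewrite lerD2l partial_homo// leq_maxl.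
have mM : (m < maxn n m.+1)%N by rewrite leq_maxr.
rewrite /partial (bigD1 (Ordinal mM))//= [leRHS](bigD1 (Ordinal mM))//= addrA.
apply: lerD.
  rewrite -{1}[t ^+ m]mulr1 -mulrDr ler_wpM2l ?exprn_ge0//.
  by rewrite addrC natr1 ler_nat level_count_ltn.
apply: ler_sum => k _; rewrite ler_wpM2l ?exprn_ge0//.
by rewrite ler_nat level_count_mono.
Qed.

End Position.

(** * Distances along the tree and the Hölder estimate at the nodes *)

Section Tree.
Variables (R : realType) (B : metricType R).
Variables (x : nat -> nat -> B) (p : nat -> nat -> nat) (K r : R).
Hypothesis p_lt : forall l i, (p l i < 2 ^ l)%N.
Hypotheses (K_gt0 : 0 < K) (r_gt0 : 0 < r) (r_lt1 : r < 1).
Hypothesis xp : forall l i, mdist (x l (p l i)) (x l.+1 i) <= K * r ^+ l.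

Lemma mdist_ancestor l i k : (k <= l)%N ->
  mdist (x k (ancestor p l i k)) (x l i) <= K / (1 - r) * r ^+ k.
Proof.
move=> kl; have r1 : 0 < 1 - r by rewrite subr_gt0.
(* Subtracting [r ^+ l] gives the exact geometric sum of the steps from level [k] to level [l], so
   the induction telescopes. *)
suff : mdist (x k (ancestor p l i k)) (x l i) <=
    K / (1 - r) * (r ^+ k - r ^+ l).
  move=> /le_trans; apply; rewrite ler_wpM2l ?divr_ge0 1?ltW//.
  by rewrite ltrBlDr ltrDl exprn_gt0.
elim: l i kl => [|l ih] i.
  rewrite leqn0 => /eqP ->.
  by rewrite ancestor_id metric_structure.mdistxx subrr mulr0.
rewrite leq_eqVlt => /predU1P[->|kl].
  by rewrite ancestor_id metric_structure.mdistxx subrr mulr0.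
rewrite ancestorS//; apply: le_trans (metric_triangle _ (x l (p l i)) _) _.
apply: le_trans (lerD (ih _ kl) (xp l i)) _.
rewrite le_eqVlt; apply/orP; left; apply/eqP.
have -> : K * r ^+ l = K / (1 - r) * (r ^+ l - r ^+ l.+1).
  by rewrite exprS -{2}[r ^+ l]mul1r -mulrBl mulrA divfK// gt_eqF.
by rewrite -mulrDr addrA subrK.
Qed.

Lemma mdist_common_ancestor l i l' i' k : (k <= l)%N -> (k <= l')%N ->
  ancestor p l i k = ancestor p l' i' k ->
  mdist (x l i) (x l' i') <= K / (1 - r) * 2 * r ^+ k.
Proof.
move=> kl kl' e.
apply: le_trans (metric_triangle _ (x k (ancestor p l i k)) _) _.
rewrite -mulrA [2 * _]mulrDl mul1r mulrDr lerD//.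
  by rewrite metric_sym mdist_ancestor.
by rewrite e mdist_ancestor.
Qed.

Lemma tree_holder (alpha t : R) : 0 < alpha -> 0 < t -> 2 * t < 1 ->
  r = t `^ alpha ->
  exists C, 0 < C /\ forall l i l' i', (i < 2 ^ l)%N -> (i' < 2 ^ l')%N ->
    mdist (x l i) (x l' i') <=
    C * `|position p t (ancestor p l i) -
          position p t (ancestor p l' i')| `^ alpha.
Proof.
move=> a0 t0 t1 rt; pose D := K / (1 - r) * 2.
have D0 : 0 < D by rewrite mulr_gt0// divr_gt0// subr_gt0.
pose b := (1 - 2 * t) `^ alpha.
have c0 : 0 < 1 - 2 * t by rewrite subr_gt0.
have b0 : 0 < b by rewrite powR_gt0.
(* Paths agreeing at level [m] give distance at most [D * r ^+ m]; [1 / r] pays for the first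
   difference occurring only at level [m.+1], and [b] comes from the factor in [position_gap]. *)
exists (D / r / b); split; first by rewrite !divr_gt0.
have main l i l' i' : (i < 2 ^ l)%N -> (i' < 2 ^ l')%N ->
    lex_lt (ancestor p l i) (ancestor p l' i') ->
    mdist (x l i) (x l' i') <= D / r / b *
    `|position p t (ancestor p l i) - position p t (ancestor p l' i')| `^ alpha.
  move=> il il' [m [eqm ltm]].
  have := position_gap p_lt t0 t1 il il' eqm ltm.
  (* Level 0 holds only the root, so paths cannot differ there; [m] now denotes the last common
     level. *)
  case: m eqm ltm => [|m] eqm ltm gap.
    by move: (ancestor_lt p_lt il' (leq0n l')); rewrite expn0; lia.
  have aml : (ancestor p l i m.+1 < 2 ^ m.+1)%N.
    by rewrite (leq_trans ltm)// ancestor_le.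
  have ml : (m <= l)%N by rewrite ltnW// (ancestor_level aml).
  have em := eqm _ (ltnSn m).
  have ml' : (m <= l')%N.
    by rewrite (@ancestor_level p l' i')// -em ancestor_lt.
  apply: le_trans (mdist_common_ancestor ml ml' em) _.
  rewrite -/D; clearbody D; rewrite -!mulrA (ler_wpM2l (ltW D0))//.
  rewrite ler_pdivlMl// ler_pdivlMl//.
  have -> : b * (r * r ^+ m) = ((1 - 2 * t) * t ^+ m.+1) `^ alpha.
    rewrite powRM ?exprn_ge0 ?(ltW c0) ?(ltW t0)// -/b -exprS rt.
    by congr (_ * _); rewrite -!powR_mulrn ?powR_ge0 ?(ltW t0)// powRAC.
  have gap0 : 0 < (1 - 2 * t) * t ^+ m.+1 by rewrite mulr_gt0 ?exprn_gt0.
  rewrite distrC ger0_norm; last exact: le_trans (ltW gap0) gap.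
  by rewrite ge0_ler_powR ?nnegrE ?(ltW a0) ?(ltW gap0)// (le_trans (ltW gap0)).
move=> l i l' i' il il'.
have [e|[lt|lt]] := lex_lt_total (ancestor p l i) (ancestor p l' i').
- suff -> : x l i = x l' i'.
    rewrite metric_structure.mdistxx mulr_ge0 ?powR_ge0// !divr_ge0// ltW//.
  (* Equal paths end at the same level: past its own level a path takes the value [2 ^ k], which is
     no node index. *)
  have ll' : l = l'.
    apply/eqP; rewrite eqn_leq; apply/andP; split.
      by rewrite (@ancestor_level p l' i')// -e ancestor_id.
    by rewrite (@ancestor_level p l i)// e ancestor_id.
  subst l'.
  by rewrite -(ancestor_id p l i) e ancestor_id.
- exact: main.
- by rewrite metric_sym distrC main.
Qed.

End Tree.

(** * Closure of a Hölder relation and its projections *)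

Section HolderRelation.
Variables (R : realType) (B : metricType R) (E : set (R * B)) (alpha C : R).
Hypotheses (alpha_gt0 : 0 < alpha) (C_gt0 : 0 < C).
Hypothesis EH : forall u v, E u -> E v ->
  mdist u.2 v.2 <= C * `|u.1 - v.1| `^ alpha.

Lemma closure_mdist_approx (u : R * B) e : closure E u -> 0 < e ->
  exists2 v, E v & `|u.1 - v.1| < e /\ mdist u.2 v.2 < e.
Proof.
move=> clu e0; have [|v [Ev]] := clu (ball u.1 e `*` ball u.2 e).
  by exists (ball u.1 e, ball u.2 e) => //; split; exact: nbhsx_ballx.
rewrite /= ballEmdist => -[v1 v2]; exists v => //.
Qed.

(** Approximation gives the estimate with any [y > d] in place of the distance [d]; undoing the
    power by [alpha^-1] then lets [y] decrease to [d]. *)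
Lemma closure_holder (u v : R * B) : closure E u -> closure E v ->
  mdist u.2 v.2 <= C * `|u.1 - v.1| `^ alpha.
Proof.
move=> clu clv; set d := `|u.1 - v.1|.
have d0 : 0 <= d by exact: normr_ge0.
have a_ge0 := ltW alpha_gt0.
have approx y : d < y -> mdist u.2 v.2 <= C * y `^ alpha.
  move=> dy; apply/ler_addgt0Pr => e e0.
  (* Moving both points by less than [f] costs at most [e] in [B] and keeps the distance on the line
     below [y]. *)
  pose f := Num.min (e / 2) ((y - d) / 2).
  have f0 : 0 < f by rewrite lt_min !divr_gt0// subr_gt0.
  have fe : f <= e / 2 by rewrite ge_min lexx.
  have fy : f <= (y - d) / 2 by rewrite ge_min lexx orbT.
  have [u' Eu' [u1 u2]] := closure_mdist_approx clu f0.
  have [v' Ev' [v1 v2]] := closure_mdist_approx clv f0.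
  have h := EH Eu' Ev'.
  have t1 := metric_triangle u.2 u'.2 v.2.
  have t2 := metric_triangle u'.2 v'.2 v.2.
  rewrite (metric_sym v'.2) in t2.
  have h2 : C * `|u'.1 - v'.1| `^ alpha <= C * y `^ alpha.
    rewrite (ler_wpM2l (ltW C_gt0))// ge0_ler_powR// ?nnegrE ?normr_ge0//.
      by rewrite (le_trans d0)// ltW.
    have -> : u'.1 - v'.1 = (u.1 - v.1) - (u.1 - u'.1) + (v.1 - v'.1) by lra.
    have n1 := ler_normD (u.1 - v.1 - (u.1 - u'.1)) (v.1 - v'.1).
    have n2 := ler_normB (u.1 - v.1) (u.1 - u'.1).
    rewrite -/d in n2; lra.
  lra.
have M0 : 0 <= mdist u.2 v.2 / C by rewrite divr_ge0// ?mdist_ge0// ltW.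
rewrite mulrC -ler_pdivrMr//.
suff : (mdist u.2 v.2 / C) `^ alpha^-1 <= d.
  move=> /(ge0_ler_powR a_ge0); rewrite !nnegrE powR_ge0 => /(_ isT d0).
  by rewrite -powRrM mulVf ?gt_eqF// powRr1.
apply/ler_addgt0Pr => e e0.
have dy : d < d + e by rewrite ltrDl.
have := approx _ dy; rewrite mulrC -ler_pdivrMr//.
move=> /(@ge0_ler_powR _ alpha^-1); rewrite invr_ge0 !nnegrE powR_ge0.
move=> /(_ a_ge0 M0 isT); rewrite -powRrM mulfV ?gt_eqF// powRr1//.
by rewrite addr_ge0// ltW.
Qed.

(** The closure of [E] is compact, hence so are its projections: the first is [D], the second is
    closed and dense, thus all of [B]. *)
Lemma compact_holder_surjection : compact [set: B] ->
  E `<=` [set u | 0 <= u.1 <= 1] ->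
  (forall b e, 0 < e -> exists2 v, E v & mdist v.2 b < e) ->
  exists (D : set R) (g : D -> B),
    [/\ D `<=` `[0, 1], compact D, holder (X := R^o) (D := D) alpha g
      & range g = [set: B] ].
Proof.
move=> cptB E01 dense.
have cptI : compact (`[0, 1]%classic `*` [set: B] : set (R * B)).
  by apply: compact_setX => //; exact: segment_compact.
have clI : closed (`[0, 1]%classic `*` [set: B] : set (R * B)).
  have -> : `[0, 1]%classic `*` [set: B] = fst @^-1` `[(0:R), 1]%classic.
    by apply/seteqP; split => u // [].
  apply: preimage_closed; last exact: itv_closed.
  by move=> u _; exact: cvg_fst.
have clE : closure E `<=` `[0, 1]%classic `*` [set: B].
  rewrite ((closure_id _).1 clI); apply: closureS => u /E01 u01.
  by split => //=; rewrite in_itv.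
have cptE : compact (closure E).
  exact: subclosed_compact (@closed_closure _ E) cptI clE.
exists (fst @` closure E).
have ex (d : fst @` closure E) : exists b, closure E (\val d, b).
  by have [[d1 b] Eb <-] := set_valP d; exists b.
(* The choice is forced: the estimate at distance zero leaves a single point of the closure over
   each [d]. *)
have [g gE] := choice ex.
exists g; split.
- by move=> _ [u /clE[] + _ <-].
- apply: continuous_compact cptE; apply: continuous_subspaceT => u.
  exact: cvg_fst.
- exists C => u v.
  have := closure_holder (gE u) (gE v).
  by rewrite /= (distrC (\val u)).
- apply/seteqP; split => // b _.
  have cb : closure (snd @` closure E) b.
    move=> V /nbhs_ballP[e e0]; rewrite ballEmdist => eV.
    have [v Ev vb] := dense b _ e0.
    exists v.2; split; first by exists v => //; exact: subset_closure.
    by apply: eV; rewrite /= metric_sym.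
  have : (snd @` closure E) b.
    suff /closure_id -> : closed (snd @` closure E) by [].
    apply: compact_closed; first exact: metric_hausdorff.
    apply: continuous_compact cptE; apply: continuous_subspaceT => u.
    exact: cvg_snd.
  move=> [[d b'] Eb /= bb']; subst b'.
  have dD : (fst @` closure E) d by exists (d, b).
  exists (exist _ d (mem_set dD)) => //.
  apply: mdist_positivity; apply/eqP; rewrite eq_le mdist_ge0 andbT.
  have := closure_holder (gE (exist _ d (mem_set dD))) Eb.
  by rewrite /= subrr normr0 powR0 ?gt_eqF// mulr0.
Qed.

End HolderRelation.

(** * From the box dimension to nets of [2 ^ k] points *)

Section Covers.
Variables (R : realType) (B : metricType R).

Lemma upper_box_dim_cover (a : R) (b : B) : 0 < a ->
  (upper_box_dim B < a%:E)%E ->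
  exists s d : R, [/\ 0 < s < a, 0 < d <= 1 & forall r, 0 < r < d ->
    exists2 c : seq B, ball_cover r c & (size c)%:R < r `^ (- s)].
Proof.
move=> a0; rewrite /upper_box_dim.
have -> : ([set: B] == set0) = false by apply/negbTE/set0P; exists b.
rewrite limf_esupE => /ereal_inf_lt[_ [V V0 <-] supVa].
(* The maximum with 0 below keeps [s] positive when the supremum is negative. *)
have [s sup_s s0a] : exists2 s,
    (ereal_sup ((fun r => lne (covering_number B r) / (ln r^-1)%:E) @` V) <
     s%:E)%E & 0 < s < a.
  case: (ereal_sup _) supVa => [y| |] //; last first.
    by move=> _; exists (a / 2); [exact: ltNyr|lra].
  rewrite lte_fin => ya; exists ((Num.max y 0 + a) / 2); rewrite ?lte_fin.
    by have := le_max y y 0; rewrite lexx; lra.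
  have : Num.max y 0 < a by rewrite gt_max ya.
  by have := le_max 0 y 0; rewrite lexx orbT; lra.
case: V0 => d /= d0 dV.
(* Radii below 1 make [ln r^-1] positive, so the quotient can be cleared. *)
exists s, (Num.min d 1); split => //.
  by rewrite lt_min d0 ltr01 ge_min lexx orbT.
move=> r /andP[r0]; rewrite lt_min => /andP[rd r1].
have lr : 0 < ln r^-1 by rewrite ln_gt0// invf_gt1.
have : (lne (covering_number B r) / (ln r^-1)%:E < s%:E)%E.
  apply: le_lt_trans sup_s; apply: ereal_sup_ubound; exists r => //.
  by apply: dV => //=; rewrite sub0r normrN gtr0_norm.
rewrite inver gt_eqF// lte_pdivrMr// -EFinM -lte_expeR lneK; last first.
  rewrite in_itv/= leey andbT.
  by apply: le_ereal_inf_tmp => _ [c _ <-]; rewrite lee_fin.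
rewrite /= => /ereal_inf_lt[_ [c rc <-]]; rewrite lte_fin => cs.
exists c => //; apply: lt_le_trans cs _.
by rewrite /powR gt_eqF// lnV// mulrN mulNr.
Qed.

Lemma dyadic_nets (b0 : B) (r : R) (k0 : nat) : 0 < r < 1 ->
  (forall k, (k0 <= k)%N ->
    exists2 c : seq B, ball_cover (r ^+ k) c & (size c <= 2 ^ k)%N) ->
  exists (x : nat -> nat -> B) (K : R), 0 < K /\
    forall k b, exists2 i, (i < 2 ^ k)%N & mdist (x k i) b <= K * r ^+ k.
Proof.
move=> /andP[r0 r1] cov.
have ex k : exists c : seq B, (k0 <= k)%N -> ball_cover (r ^+ k) c /\
    (size c <= 2 ^ k)%N.
  have [/cov[c]|] := leqP k0 k; first by exists c.
  by exists [::].
have [c cP] := choice ex.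
(* [M] bounds the distance from [b0] to any point, going through a centre of the cover of level
   [k0]. *)
pose M := \sum_(y <- c k0) mdist b0 y + r ^+ k0.
have M0 : 0 < M.
  by rewrite ltr_wpDl ?exprn_gt0//; apply: sumr_ge0 => *; exact: mdist_ge0.
have bM b : mdist b0 b <= M.
  have [/(_ b Logic.I)[y /= yc yb] _] := cP k0 (leqnn _).
  apply: le_trans (metric_triangle _ y _) _; rewrite lerD//.
  elim: (c k0) yc => // z l ih; rewrite inE big_cons => /predU1P[->|/ih yl].
    by rewrite lerDl; apply: sumr_ge0 => *; exact: mdist_ge0.
  by rewrite (le_trans yl)// lerDr mdist_ge0.
(* Below level [k0] the point [b0] alone serves as net, and it pads the later lists. In [K] the 1
   serves the levels from [k0] on; earlier, [M / r ^+ k0 * r ^+ k] is at least [M]. *)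
exists (fun k i => if (k0 <= k)%N then nth b0 (c k) i else b0).
exists (1 + M / r ^+ k0); split.
  by rewrite addr_gt0// divr_gt0// exprn_gt0.
move=> k b; have [k0k|kk0] := leqP k0 k.
  have [/(_ b Logic.I)[y /= yc yb] sc] := cP k k0k.
  exists (index y (c k)); first by rewrite (leq_trans _ sc)// index_mem.
  rewrite nth_index// (le_trans yb)// mulrDl mul1r lerDl.
  by rewrite mulr_ge0 ?divr_ge0 ?exprn_ge0// ltW.
exists 0%N; first by rewrite expn_gt0.
apply: le_trans (bM b) _; rewrite mulrDl mul1r.
apply: (@le_trans _ _ (M / r ^+ k0 * r ^+ k)); last first.
  by rewrite lerDr exprn_ge0// ltW.
rewrite -mulrA ler_peMr ?(ltW M0)// ler_pdivlMl ?exprn_gt0// mulr1.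
by rewrite ler_wiXn2l ?(ltW r0) ?(ltW r1) ?(ltnW kk0).
Qed.

End Covers.

(** * Choice of the parameters and assembly of the map *)

Theorem corollary1p15 (R : realType) (alpha : R) (B : metricType R)
    (halpha : 0 < alpha) (hB : compact [set: B])
    (hdim : (upper_box_dim B < (1 / alpha)%:E)%E) :
  exists (D : set R) (g : D -> B),
    [/\ D `<=` `[0, 1], compact D,
        holder (X := R^o) (D := D) alpha g
      & range g = [set: B] ].
Proof.
have [B0|/set0P[b0 _]] := eqVneq [set: B] set0.
  exists set0, (fun d : set0 => False_rect B (set_valP d)); split => //.
  - exact: compact0.
  - by exists 0 => u; case: (set_valP u).
  - apply/seteqP; split => // b _.
    by have := B0; rewrite -subset0 => /(_ b Logic.I).
have ia0 : 0 < 1 / alpha by rewrite divr_gt0.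
have [s [d [/andP[s0 sa] /andP[d0 d1] cov]]] := upper_box_dim_cover b0 ia0 hdim.
have h0 : 0 < 2^-1 :> R by rewrite invr_gt0.
(* This exponent makes the bound on covers of radius [r ^+ k] equal to [2 ^ k]; [s * alpha < 1]
   gives [q > 1], whence [t < 1/2]. *)
pose q := (s * alpha)^-1; pose t := 2^-1 `^ q; pose r := t `^ alpha.
have q1 : 1 < q by rewrite /q invf_gt1 ?mulr_gt0// -ltr_pdivlMr.
have t0 : 0 < t by rewrite powR_gt0.
have t2 : 2 * t < 1.
  rewrite -ltr_pdivlMl// mulr1 -ltr_ln ?posrE// ln_powR.
  have : ln (2^-1) < 0 :> R by rewrite ln_lt0// h0/= invf_lt1// ltr1n.
  by nra.
have r0 : 0 < r by rewrite powR_gt0.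
have rE : r = 2^-1 `^ s^-1.
  by rewrite /r /t -powRrM /q invfM -mulrA mulVf ?mulr1// gt_eqF.
have rs k : (r ^+ k) `^ (- s) = (2 ^ k)%:R.
  rewrite -powR_mulrn ?(ltW r0)// rE -!powRrM mulrCA mulrN mulVf ?gt_eqF//.
  by rewrite mulrN1 powR_invn ?(ltW h0)// exprVn invrK natrX.
have r1 : r < 1.
  rewrite -ltr_ln ?posrE// ln1 rE ln_powR pmulr_rlt0 ?invr_gt0//.
  by rewrite ln_lt0// h0/= invf_lt1// ltr1n.
have small e : 0 < e -> exists k0, forall k, (k0 <= k)%N -> r ^+ k < e.
  move=> e0; have /cvgrPdist_lt/(_ e e0)[k0 _ k0P] :
      (r ^+ k @[k --> \oo] --> 0).
    by apply: cvg_expr; rewrite gtr0_norm.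
  by exists k0 => k /k0P/=; rewrite sub0r normrN gtr0_norm ?exprn_gt0.
have [k0 k0P] := small _ d0.
have [|k k0k|x [K [K0 xP]]] := @dyadic_nets R B b0 r k0.
- by rewrite r0.
- have [|c rc cs] := cov (r ^+ k); first by rewrite exprn_gt0//= k0P.
  by exists c => //; move: cs; rewrite rs ltr_nat => /ltnW.
(* The net of level [l] comes near every point of [B], so a parent exists for every index, even one
   outside the range of its level. *)
have ex (li : nat * nat) : exists j, (j < 2 ^ li.1)%N /\
    mdist (x li.1 j) (x li.1.+1 li.2) <= K * r ^+ li.1.
  by have [j] := xP li.1 (x li.1.+1 li.2); exists j.
have [p' pP] := choice ex; pose p l i := p' (l, i).
have p_lt l i : (p l i < 2 ^ l)%N := (pP (l, i)).1.
have xp l i : mdist (x l (p l i)) (x l.+1 i) <= K * r ^+ l := (pP (l, i)).2.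
have [C [C0 CP]] := tree_holder p_lt K0 r0 r1 xp halpha t0 t2 erefl.
pose E := [set u : R * B | exists l i, (i < 2 ^ l)%N /\
  u = (position p t (ancestor p l i), x l i)].
apply: (@compact_holder_surjection R B E alpha C) => //.
- by move=> _ _ [l [i [il ->]]] [l' [i' [il' ->]]]; exact: CP.
- by move=> _ [l [i [il ->]]]; rewrite /= position_ge0// position_le1.
move=> b e e0; have [k kP] := small (e / K) (divr_gt0 e0 K0).
have [i ik xb] := xP k b.
exists (position p t (ancestor p k i), x k i); first by exists k, i.
by rewrite (le_lt_trans xb)// mulrC -ltr_pdivlMr// kP.
Qed.
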